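(* For every integer $k\ge 1$, $\alpha_{3,2k+1}$ is equal to the number of ternary words of length $k+1$ over the alphabet $\{1,2,3\}$ containing at least one occurrence of $13$ or $31$ as a factor. This number is given by the term A193519$(k+1)$ of the OEIS sequence A193519.
   Context: For integers $n,m\ge 1$, the grid $G(n,m)$ has cell set $V_{n,m}=\{(i,j): 1\le i\le n,\ 1\le j\le m\}$ ($i$ = row, $j$ = column). Contamination rules: a cell $u=(i,j)\in V_{n,m}$ can be contaminated by two contaminated cells $v,w\in V_{n,m}$ if one of the following holds: (a) $v=(i-1,j-1)$, $w=(i+1,j+1)$; (b) $v=(i+1,j-1)$, $w=(i-1,j+1)$; (c) $v=(i-1,j)$, $w=(i+1,j)$; (d) $v=(i,j-1)$, $w=(i,j+1)$; (e) $v=(i,j-1)$, $w=(i-1,j)$; (f) $v=(i,j-1)$, $w=(i+1,j)$; (g) $v=(i+1,j)$, $w=(i,j+1)$; (h) $v=(i-1,j)$, $w=(i,j+1)$. For $S\subseteq V_{n,m}$, the final contaminated set $C(S)$ is the smallest subset of $V_{n,m}$ containing $S$ and closed under rules (a)--(h). $S$ is a contaminating set if $C(S)=V_{n,m}$. The power contamination number $\gamma_c(G(n,m))$ is the minimum cardinality of a contaminating set; a contaminating set of this cardinality is an optimal solution. $\alpha_{n,m}$ denotes the number of optimal solutions of $G(n,m)$. A factor of a word $w_1\cdots w_t$ is a contiguous block $w_iw_{i+1}\cdots w_j$. Here A193519$(N)$ is understood as $3^{N}-u_{N}$, where $u_N$ is the number of words of length $N$ over $\{1,2,3\}$ avoiding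 both factors $13$ and $31$. *)

(* Defs.v *)
From mathcomp Require Import all_boot.

Set Implicit Arguments.
Unset Strict Implicit.
Unset Printing Implicit Defensive.

(* Rows and columns are numbered from 0; the contamination rules only involve
   differences of coordinates. *)
Notation cell n m := ('I_n * 'I_m)%type.

Section Grid.

Variables n m : nat.
Implicit Types (u v w : cell n m) (S T : {set cell n m}).

(* [at_NW u v] says that v = (i-1,j-1) where u = (i,j), and so on. Each
   equation i' = i-1 is written i'.+1 = i, so that it fails when i = 0. *)
Definition at_NW u v := (v.1.+1 == u.1 :> nat) && (v.2.+1 == u.2 :> nat).
Definition at_N  u v := (v.1.+1 == u.1 :> nat) && (v.2 == u.2 :> nat).
Definition at_NE u v := (v.1.+1 == u.1 :> nat) && (v.2 == u.2.+1 :> nat).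
Definition at_W  u v := (v.1 == u.1 :> nat) && (v.2.+1 == u.2 :> nat).
Definition at_E  u v := (v.1 == u.1 :> nat) && (v.2 == u.2.+1 :> nat).
Definition at_SW u v := (v.1 == u.1.+1 :> nat) && (v.2.+1 == u.2 :> nat).
Definition at_S  u v := (v.1 == u.1.+1 :> nat) && (v.2 == u.2 :> nat).
Definition at_SE u v := (v.1 == u.1.+1 :> nat) && (v.2 == u.2.+1 :> nat).

(* Two contaminated neighbours on opposite sides of u (diagonals included), or
   two side-adjacent neighbours in perpendicular directions. *)
Definition contaminated_by u v w : bool :=
  [|| at_NW u v && at_SE u w,
      at_SW u v && at_NE u w,
      at_N u v && at_S u w,
      at_W u v && at_E u w,
      at_W u v && at_N u w,
      at_W u v && at_S u w,
      at_S u v && at_E u w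
    | at_N u v && at_E u w].

Definition rule_closed T : bool :=
  [forall u, forall v in T, forall w in T, contaminated_by u v w ==> (u \in T)].

Definition contamination S : {set cell n m} :=
  \bigcap_(T : {set cell n m} | (S \subset T) && rule_closed T) T.

Definition contaminating S : bool := contamination S == [set: cell n m].

(* The default value [set: _] of [arg min] is itself contaminating, by
   [contaminatingT], so that this is the minimum (see [gamma_cP]). *)
Definition gamma_c : nat :=
  #|[arg min_(S < [set: cell n m] | contaminating S) #|S|]|.

Definition optimal S : bool := contaminating S && (#|S| == gamma_c).

Definition alpha : nat := #|[set S | optimal S]|.

Lemma contaminatingT : contaminating [set: cell n m].
Proof.
rewrite /contaminating eqEsubset subsetT /=.
by apply/bigcapsP => T /andP[].
Qed.

Lemma sub_contamination S : S \subset contamination S.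
Proof. by apply/bigcapsP => T /andP[]. Qed.

Lemma contamination_closed S : rule_closed (contamination S).
Proof.
apply/forallP => u; apply/forall_inP => v /bigcapP Cv.
apply/forall_inP => w /bigcapP Cw; apply/implyP => uvw.
apply/bigcapP => T PT; have /andP[_ /forallP/(_ u)/forall_inP cT] := PT.
by have /forall_inP/(_ w (Cw T PT))/implyP/(_ uvw) := cT v (Cv T PT).
Qed.

Lemma contamination_min S T :
  S \subset T -> rule_closed T -> contamination S \subset T.
Proof. by move=> ST cT; apply: bigcap_inf; rewrite ST cT. Qed.

Lemma gamma_cP :
  (exists2 S, contaminating S & #|S| = gamma_c) /\
  (forall S, contaminating S -> gamma_c <= #|S|).
Proof.
rewrite /gamma_c; case: arg_minnP => [|S cS minS]; first exact: contaminatingT.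
by split=> //; exists S.
Qed.

End Grid.

(* The element of value i of 'I_3 stands for the letter i+1. *)
Notation ternary_word N := (N.-tuple 'I_3).

Definition letter1 : 'I_3 := ord0.
Definition letter3 : 'I_3 := ord_max.

Definition has13or31 (w : seq 'I_3) : bool :=
  infix [:: letter1; letter3] w || infix [:: letter3; letter1] w.

Definition avoids13and31 (w : seq 'I_3) : bool :=
  ~~ infix [:: letter1; letter3] w && ~~ infix [:: letter3; letter1] w.

Definition avoiding_count (N : nat) : nat := #|[set w : ternary_word N | avoids13and31 w]|.

(* The subtraction never truncates: there are 3 ^ N words of length N. *)
Definition A193519 (N : nat) : nat := 3 ^ N - avoiding_count N.

(* Main.v *)
Require Import Defs.
From mathcomp Require Import all_boot.
From mathcomp Require Import zify.

Set Implicit Arguments.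
Unset Strict Implicit.
Unset Printing Implicit Defensive.

(**
Two adjacent columns free of S stay free, and so does an empty first or last
column. The blocks {0}, {1,2}, ..., {2k-1,2k} of columns, and likewise
{0,1}, ..., {2k-2,2k-1}, {2k}, thus each meet a contaminating set, which has
therefore at least k+1 cells; if it has exactly k+1, then it has one cell in
each even column (numbered from 0) and no other, so it is the graph of a word.
A factor 13 or 31 spreads to a full 3 x 3 block, hence to the whole grid. When
there is no such factor, only the cells between two equal consecutive letters
get contaminated.
*)

(** * Closed sets and empty columns *)

Section Closure.

Variables n m : nat.
Implicit Types (S T : {set cell n m}).

Lemma rule_closedP T :
  reflect (forall u v w, v \in T -> w \in T -> contaminated_by u v w -> u \in T)
          (rule_closed T).
Proof.
apply: (iffP forallP) => [cT u v w vT wT | cT u].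
  by have /forall_inP/(_ v vT)/forall_inP/(_ w wT)/implyP := cT u.
apply/forall_inP => v vT; apply/forall_inP => w wT.
by apply/implyP; apply: cT vT wT.
Qed.

(* Shifting the columns by one makes a = 0 stand for the first column alone;
   likewise a = m stands for the last one. *)
Lemma contaminating_column_pair S a :
  0 < n -> 0 < m -> a <= m -> contaminating S ->
  exists2 u : cell n m, u \in S & (u.2.+1 == a) || (u.2.+1 == a.+1).
Proof.
move=> n0 m0 am /eqP cS.
pose P (u : cell n m) := (u \in S) && ((u.2.+1 == a) || (u.2.+1 == a.+1)).
case: (pickP P) => [u|noS].
  by case/andP => uS ua; exists u.
(* Each rule for a cell of column j uses a cell of column j, or one cell in each of columns j-1 and
   j+1. For j in the pair, one of these cells is in the pair or outside the grid, so [T] is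
   closed. *)
pose T : {set cell n m} := [set u : cell n m | (u.2.+1 != a) && (u.2.+1 != a.+1)].
have ST : S \subset T.
  by apply/subsetP => u uS; have := noS u; rewrite /P !inE uS /= => /negbT; lia.
have cT : rule_closed T.
  apply/rule_closedP => -[u1 u2] [v1 v2] [w1 w2]; rewrite !inE /contaminated_by.
  rewrite /at_NW /at_N /at_NE /at_W /at_E /at_SW /at_S /at_SE /=; lia.
have := contamination_min ST cT; rewrite cS => /subsetP sT.
(* Column [a.-1] belongs to the pair, even for [a = 0], where it is the first column. *)
have am' : a.-1 < m by lia.
have := sT (Ordinal n0, Ordinal am') (in_setT _); rewrite inE /=; lia.
Qed.

(** * Spread of full columns *)

Section ClosedSet.

Variable T : {set cell n m}.
Hypothesis cT : rule_closed T.

Definition contaminated_at x y :=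
  exists2 u : cell n m, u \in T & (u.1 == x :> nat) && (u.2 == y :> nat).

Lemma contaminated_at_ord (x : 'I_n) (y : 'I_m) : contaminated_at x y -> (x, y) \in T.
Proof. by move=> [[u1 u2] uT /= /andP[/eqP/val_inj<- /eqP/val_inj<-]]. Qed.

(* The last disjunct covers rules (e)--(h). *)
Lemma contaminated_at_rule x y a b c d :
  contaminated_at a b -> contaminated_at c d -> x < n -> y < m ->
  [|| [&& a.+1 == x, b.+1 == y, c == x.+1 & d == y.+1],
      [&& a == x.+1, b.+1 == y, c.+1 == x & d == y.+1],
      [&& a == x, b.+1 == y, c == x & d == y.+1]
    | ((a.+1 == x) || (a == x.+1)) && (b == y) &&
      (c == x) && ((d.+1 == y) || (d == y.+1))] ->
  contaminated_at x y.
Proof.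
move=> [[v1 v2] vT /= /andP[/eqP<- /eqP<-]] [[w1 w2] wT /= /andP[/eqP<- /eqP<-]].
move=> xn ym H; suff uT : (Ordinal xn, Ordinal ym) \in T.
  by exists (Ordinal xn, Ordinal ym); rewrite ?eqxx.
have rule := elimT (rule_closedP T) cT.
rewrite /contaminated_by /at_NW /at_N /at_NE /at_W /at_E /at_SW /at_S /at_SE in rule.
case/or4P: H => [/and4P[a1 a2 a3 a4]|/and4P[a1 a2 a3 a4]|/and4P[a1 a2 a3 a4]|
    /andP[/andP[/andP[/orP[]a1 a2] a3] /orP[]a4]];
  first [ by apply: rule vT wT _; rewrite /= a1 a2 a3 a4 ?orbT
        | by apply: rule wT vT _; rewrite /= a1 a2 a3 a4 ?orbT ].
Qed.

Definition full_column y := forall x, x < n -> contaminated_at x y.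

(** Contamination runs up and down column [d] from row [x]: each new cell has one neighbour in [d]
    and one in [c], at a right angle. *)
Lemma full_column_step x c d :
  full_column c -> x < n -> d < m -> contaminated_at x d ->
  (c == d.+1) || (d == c.+1) -> full_column d.
Proof.
move=> fc xn dm xd cd.
have up y : x + y < n -> contaminated_at (x + y) d.
  elim: y => [|y IH]; rewrite ?addn0 // => lt.
  by apply: (contaminated_at_rule (IH _) (fc (x + y.+1) _)) => //; lia.
have down y : y <= x -> contaminated_at (x - y) d.
  elim: y => [|y IH]; rewrite ?subn0 // => lt.
  by apply: (contaminated_at_rule (IH _) (fc (x - y.+1) _)) => //; lia.
move=> z zn; have [xz|zx] := leqP x z.
  by rewrite -(subnKC xz); apply: up; lia.
by rewrite (_ : z = x - (x - z)); [apply: down|]; lia.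
Qed.

(** By rule (d) in row [x], the column [e] between [c] and [d] gets a cell, so it fills up, and then
    [d] does. *)
Lemma full_column_jump x c d :
  full_column c -> x < n -> c < m -> d < m -> contaminated_at x d ->
  (c == d.+2) || (d == c.+2) -> full_column d.
Proof.
move=> fc xn cm dm xd cd.
pose e := (minn c d).+1.
have xe : contaminated_at x e.
  case/orP: cd => ?; first by apply: (contaminated_at_rule xd (fc x xn)); lia.
  by apply: (contaminated_at_rule (fc x xn) xd); lia.
have fe : full_column e by apply: (full_column_step fc xn _ xe); lia.
by apply: (full_column_step fe xn _ xd); lia.
Qed.

End ClosedSet.

End Closure.

Lemma infix2P (A : eqType) (x0 a b : A) (s : seq A) :
  reflect (exists2 i, i.+1 < size s & nth x0 s i = a /\ nth x0 s i.+1 = b)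
          (infix [:: a; b] s).
Proof.
apply: (iffP (@infixP A [:: a; b] s)) => [[p [q ->]] | [i lti [<- <-]]].
  exists (size p); first by rewrite !size_cat /=; lia.
  by split; rewrite nth_cat ?ltnn ?subnn // ltnNge leqnSn subSnn.
exists (take i s), (drop i.+2 s).
by rewrite /= -!drop_nth ?cat_take_drop //; lia.
Qed.

(** * Three rows: graphs of words and what they contaminate *)

Section ThreeRows.

Variable k : nat.
Notation m := (2 * k + 1).
Notation word := (ternary_word (k + 1)).
Implicit Types (w : word) (S : {set cell 3 m}).

Lemma even_column_subproof (i : 'I_(k + 1)) : 2 * i < m.
Proof. by case: i => i /=; lia. Qed.

Definition even_column i : 'I_m := Ordinal (even_column_subproof i).

Definition word_graph w : {set cell 3 m} :=
  [set (tnth w i, even_column i) | i : 'I_(k + 1)].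

Lemma card_word_graph w : #|word_graph w| = k + 1.
Proof.
by rewrite card_imset ?card_ord // => i j [_ ij]; apply: ord_inj; lia.
Qed.

Lemma word_graph_inj : injective word_graph.
Proof.
move=> w1 w2 eq12; apply: eq_from_tnth => i.
have : (tnth w1 i, even_column i) \in word_graph w2 by rewrite -eq12 imset_f.
by case/imsetP => j _ [-> ij]; congr tnth; apply: ord_inj; lia.
Qed.

Lemma contaminated_at_word_graph (T : {set cell 3 m}) w i :
  word_graph w \subset T -> i < k + 1 -> contaminated_at T (nth ord0 w i) (2 * i).
Proof.
move=> /subsetP wT lti; exists (nth ord0 w i, even_column (Ordinal lti)).
  by apply/wT/imsetP; exists (Ordinal lti); rewrite ?(tnth_nth ord0).
by rewrite !eqxx.
Qed.

(** The two letters are opposite corners of a 3 x 3 block. A diagonal rule contaminates its centre,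
    and right-angle rules then complete its left column. *)
Lemma full_column_has13or31 (T : {set cell 3 m}) w :
  rule_closed T -> word_graph w \subset T -> has13or31 w ->
  exists2 i, i < k + 1 & full_column T (2 * i).
Proof.
move=> cT wT w13.
have rule := contaminated_at_rule cT.
case/orP: w13 => /(infix2P ord0 _ _ _)[i]; rewrite size_tuple => lti [wi wi1];
  (exists i; first by lia);
  have := contaminated_at_word_graph wT lti;
  have := @contaminated_at_word_graph T w i wT ltac:(lia);
  rewrite wi wi1 /= => q0 q2.
(* The digits of [q11] and the like are the row and the column offset from [2 * i]; [q0] and [q2]
   are the two letters. *)
- have q11 : contaminated_at T 1 (2 * i).+1 by apply: (rule _ _ _ _ _ _ q0 q2); lia.
  have q01 : contaminated_at T 0 (2 * i).+1 by apply: (rule _ _ _ _ _ _ q11 q0); lia.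
  have q10 : contaminated_at T 1 (2 * i) by apply: (rule _ _ _ _ _ _ q0 q11); lia.
  have q21 : contaminated_at T 2 (2 * i).+1 by apply: (rule _ _ _ _ _ _ q11 q2); lia.
  have q20 : contaminated_at T 2 (2 * i) by apply: (rule _ _ _ _ _ _ q10 q21); lia.
  by move=> [|[|[|]]].
- have q11 : contaminated_at T 1 (2 * i).+1 by apply: (rule _ _ _ _ _ _ q0 q2); lia.
  have q01 : contaminated_at T 0 (2 * i).+1 by apply: (rule _ _ _ _ _ _ q11 q2); lia.
  have q10 : contaminated_at T 1 (2 * i) by apply: (rule _ _ _ _ _ _ q0 q11); lia.
  have q00 : contaminated_at T 0 (2 * i) by apply: (rule _ _ _ _ _ _ q10 q01); lia.
  by move=> [|[|[|]]].
Qed.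

Lemma contaminating_has13or31 w : has13or31 w -> contaminating (word_graph w).
Proof.
move=> w13; rewrite /contaminating -subTset; apply/subsetP => -[x y] _.
set T := contamination _.
have wT : word_graph w \subset T by apply: sub_contamination.
have cT : rule_closed T by apply: contamination_closed.
have [i lti fi] := full_column_has13or31 cT wT w13.
(* Every even column holds a letter, from which it fills up once a neighbouring even column is
   full. *)
have jump a b : a < k + 1 -> b < k + 1 -> (a == b.+1) || (b == a.+1) ->
    full_column T (2 * a) -> full_column T (2 * b).
  move=> lta ltb ab fa.
  by apply: (full_column_jump cT fa (ltn_ord _) _ _ (contaminated_at_word_graph wT ltb)); lia.
have right d : i + d < k + 1 -> full_column T (2 * (i + d)).
  elim: d => [|d IH] ltd; first by rewrite addn0.
  by apply: jump (IH _); lia.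
have left d : d <= i -> full_column T (2 * (i - d)).
  elim: d => [|d IH] ltd; first by rewrite subn0.
  by apply: jump (IH _); lia.
have even j : j < k + 1 -> full_column T (2 * j).
  move=> ltj; have [ij|ji] := leqP i j; first by rewrite -(subnKC ij); apply: right; lia.
  by rewrite (_ : j = i - (i - j)); [apply: left|]; lia.
apply/contaminated_at_ord; have ym := ltn_ord y.
have [oy|ey] := boolP (odd y); last first.
  by rewrite (_ : y = 2 * y./2 :> nat); [apply: (even _ _ x (ltn_ord x))|]; lia.
have xn := ltn_ord x.
by apply: (contaminated_at_rule cT (even y./2 _ x xn) (even (y./2).+1 _ x xn) xn ym); lia.
Qed.

(* The cells of the word together with those between two equal consecutive
   letters: [c./2] and [uphalf c] are the positions next to column [c], and
   they coincide when [c] is even. *)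
Definition word_closure w : {set cell 3 m} :=
  [set u : cell 3 m | (nth ord0 w u.2./2 == u.1) && (nth ord0 w (uphalf u.2) == u.1)].

(** Cells of the set in the same column or in adjacent columns share their row, which excludes (c)
    and (e)--(h). Consecutive letters differ by at most 1, which excludes (a) and (b). A cell added
    by (d) is already in the set. *)
Lemma word_closure_closed w : ~~ has13or31 w -> rule_closed (word_closure w).
Proof.
rewrite negb_or => /andP[no13 no31].
have near (j : 'I_m) : nth ord0 w j./2 <= (nth ord0 w (uphalf j)).+1
    /\ nth ord0 w (uphalf j) <= (nth ord0 w j./2).+1.
  have jm := ltn_ord j.
  have [oj|ej] := boolP (odd j); last first.
    by rewrite (_ : uphalf j = j./2); [split|]; lia.
  have ltj : (j./2).+1 < size w by rewrite size_tuple; lia.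
  have -> : uphalf j = (j./2).+1 by lia.
  move: no13 no31 (ltn_ord (nth ord0 w j./2)) (ltn_ord (nth ord0 w (j./2).+1)).
  move=> /(infix2P ord0 _ _ _) no13 /(infix2P ord0 _ _ _) no31 lt1 lt2.
  have n13 : ~ (nth ord0 w j./2 = 0 :> nat /\ nth ord0 w (j./2).+1 = 2 :> nat).
    by case=> e1 e2; apply: no13; exists j./2 => //; split; apply: val_inj.
  have n31 : ~ (nth ord0 w j./2 = 2 :> nat /\ nth ord0 w (j./2).+1 = 0 :> nat).
    by case=> e1 e2; apply: no31; exists j./2 => //; split; apply: val_inj.
  lia.
apply/rule_closedP => -[u1 u2] [v1 v2] [w1 w2]; rewrite !inE /=.
move=> /andP[/eqP va /eqP vb] /andP[/eqP wa /eqP wb].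
(* [j.+1./2] reduces to [uphalf j]: the right letter of a column is the left letter of the next
   one. *)
have ab : v2.+1 = w2 :> nat -> v1 = w1 :> nat by move=> e; rewrite -vb -wa -e.
have aa : v2 = w2 :> nat -> v1 = w1 :> nat by move=> e; rewrite -va -wa e.
have [n1 n2] := near u2.
have l : v2.+1 = u2 :> nat -> v1 = nth ord0 w u2./2 :> nat by move=> <-; rewrite -vb.
have r : w2 = u2.+1 :> nat -> w1 = nth ord0 w (uphalf u2) :> nat by move=> e; rewrite -wa e.
rewrite /contaminated_by /at_NW /at_N /at_NE /at_W /at_E /at_SW /at_S /at_SE /=.
do 7?[case/orP]; case/andP=> /andP[/eqP rv /eqP cv] /andP[/eqP rw /eqP cw]; try lia.
by apply/andP; split; apply/eqP/ord_inj; rewrite -?(l cv) -?(r cw).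
Qed.

Lemma contaminating_word_graph w : contaminating (word_graph w) = has13or31 w.
Proof.
apply/idP/idP; last exact: contaminating_has13or31.
apply: contraTT => no; apply/negP => /eqP cw.
have ST : word_graph w \subset word_closure w.
  apply/subsetP => u /imsetP[i _ ->]; rewrite inE /= (tnth_nth ord0).
  by rewrite mul2n doubleK uphalf_double eqxx.
have := contamination_min ST (word_closure_closed no); rewrite cw => /subsetP sT.
have m0 : 0 < m by lia.
have := sT (letter1, Ordinal m0) (in_setT _); rewrite inE => /andP[/eqP e1 _].
by have := sT (letter3, Ordinal m0) (in_setT _); rewrite inE /= e1.
Qed.

(** * Size and shape of the optimal sets *)

Lemma half_column_subproof (u : cell 3 m) : u.2./2 < k + 1.
Proof. by case: u => _ u /=; have := ltn_ord u; lia. Qed.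

Definition half_column u : 'I_(k + 1) := Ordinal (half_column_subproof u).

Lemma card_half_column S : contaminating S -> #|[set half_column u | u in S]| = k + 1.
Proof.
move=> cS; rewrite -[RHS]card_ord -cardsT; congr #|pred_of_set _|; apply/eqP.
rewrite -subTset; apply/subsetP => i _; have lti := ltn_ord i.
(* After the shift by one, this is the pair of columns 2i and 2i+1, or the last column alone when i
   = k. *)
have [||||u uS ui] := @contaminating_column_pair 3 m S (2 * i).+1 => //; try lia.
by apply/imsetP; exists u => //; apply: val_inj => /=; lia.
Qed.

Lemma contaminating_card S : contaminating S -> k + 1 <= #|S|.
Proof. by move=> /card_half_column <-; apply: leq_imset_card. Qed.

(** By cardinality, each block {2i, 2i+1} holds a single cell of [S]. If it lies in column 2i, then
    column 2i+1 is empty, so the pair {2i+1, 2i+2} has its cell in column 2i+2; induction starts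
    from the first column. *)
Lemma contaminating_word S :
  contaminating S -> #|S| = k + 1 -> exists w, S = word_graph w.
Proof.
move=> cS S_k.
have inj : {in S &, injective half_column}.
  by apply/imset_injP; rewrite card_half_column // S_k.
have col i : i < k + 1 -> exists2 u : cell 3 m, u \in S & u.2 = 2 * i :> nat.
  elim: i => [|i IH] lti.
    have [||||u uS ui] := @contaminating_column_pair 3 m S 0 => //; try lia.
    by exists u => //; lia.
  have [|v vS vi] := IH; first lia.
  have [||||u uS ui] := @contaminating_column_pair 3 m S (2 * i.+1) => //; try lia.
  exists u => //; have [//|nu] := eqVneq (u.2 : nat) (2 * i.+1).
  have uv : u = v by apply: inj => //; apply: val_inj => /=; lia.
  by rewrite uv in ui nu *; lia.
have /fin_all_exists[f fS] (i : 'I_(k + 1)) : exists r, (r, even_column i) \in S.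
  have [[r c] uS /= uc] := col i (ltn_ord i); exists r.
  by rewrite (_ : even_column i = c) //; apply: val_inj; rewrite /= uc.
exists (mktuple f); apply/esym/eqP; rewrite eqEcard card_word_graph S_k leqnn andbT.
by apply/subsetP => u /imsetP[i _ ->]; rewrite tnth_mktuple.
Qed.

Lemma gamma_c_three : 0 < k -> gamma_c 3 m = k + 1.
Proof.
move=> k0; have [[S cS <-] minS] := gamma_cP 3 m.
apply/eqP; rewrite eqn_leq contaminating_card // andbT.
(* The word 133...3 contains 13 because [0 < k] gives it at least two letters. *)
pose w : word := [tuple if i == 0 :> nat then letter1 else letter3 | i < k + 1].
have w13 : has13or31 w.
  apply/orP; left; apply/(infix2P ord0 _ _ _); exists 0; rewrite ?size_tuple; first lia.
  have [l0 l1] : 0 < k + 1 /\ 1 < k + 1 by lia.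
  by rewrite -(tnth_nth ord0 w (Ordinal l0)) -(tnth_nth ord0 w (Ordinal l1)) !tnth_mktuple.
by rewrite -(card_word_graph w); apply/minS/contaminating_has13or31.
Qed.

End ThreeRows.

Theorem proposition8 (k : nat) (hk : 1 <= k) :
  alpha 3 (2 * k + 1) = #|[set w : ternary_word (k + 1) | has13or31 w]|
  /\ #|[set w : ternary_word (k + 1) | has13or31 w]| = A193519 (k + 1).
Proof.
split.
  rewrite /alpha -(card_imset _ (@word_graph_inj k)); apply: eq_card => S.
  rewrite inE /optimal gamma_c_three //; apply/andP/imsetP => [[cS /eqP S_k]|[w]].
    have [w Sw] := contaminating_word cS S_k.
    by exists w => //; rewrite inE -contaminating_word_graph -Sw.
  by rewrite inE -contaminating_word_graph => cw ->; rewrite card_word_graph.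
(* The power of 3 becomes the number of all words, which splits into a set and its complement. *)
rewrite /A193519 /avoiding_count -[X in X ^ _]card_ord -card_tuple.
rewrite -(cardsC [set w : ternary_word (k + 1) | has13or31 w]).
rewrite (_ : ~: _ = [set w : ternary_word (k + 1) | avoids13and31 w]) ?addnK //.
by apply/setP => w; rewrite !inE negb_or.
Qed.
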